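(* For every $p_0<1$ and $\varepsilon>0$, there exists a constant $C$ such that the following holds. Let $p\in(0,p_0]$, let $V$ be a finite set, let $Y=(Y_v)_{v\in V}$ be a sequence of i.i.d. $\mathrm{Ber}(p)$ random variables, let $f:\{0,1\}^V\to[0,\infty)$ be an arbitrary increasing function, and let $X=f(Y)$. Then, for every nonnegative real $\eta$, $$-\log\Pr\big(X\le\eta\,\mathbb E[X]\big)\ \le\ (1+\varepsilon)\,\Phi_p^f\big((1-\varepsilon)\eta\big)+C.$$
   Context: Increasing means nondecreasing with respect to the coordinatewise partial order on $\{0,1\}^V$. For $q\in[0,1]^V$, $Y^{(q)}=(Y'_v)_{v\in V}$ is a sequence of independent Bernoulli variables with $\Pr(Y'_v=1)=q_v$. With natural logarithms and $0\log0=0$, let $$D_{KL}(Y^{(q)}\,\|\,Y)=\sum_{v\in V}\Big(q_v\log\frac{q_v}p+(1-q_v)\log\frac{1-q_v}{1-p}\Big)$$ be the Kullback–Leibler divergence, and for real $\eta$ $$\Phi_p^f(\eta)=\min\Big\{D_{KL}(Y^{(q)}\,\|\,Y):\ q\in[0,1]^V,\ \mathbb E[f(Y^{(q)})]\le\eta\cdot\mathbb E[f(Y)]\Big\},$$ where the minimum over an empty set is $+\infty$. Also $-\log 0=+\infty$. *)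

(* Defs.v *)
From HB Require Import structures.
From mathcomp Require Import all_boot all_order all_algebra.
From mathcomp Require Import all_classical all_reals all_analysis.

Set Implicit Arguments.
Unset Strict Implicit.
Unset Printing Implicit Defensive.

Import Order.TTheory GRing.Theory Num.Theory.

Local Open Scope classical_set_scope.
Local Open Scope ring_scope.

(* [bool] carries its canonical order [false < true]. *)
Definition increasing (R : realType) (V : finType)
    (f : {ffun V -> bool} -> R) : Prop :=
  forall x y : {ffun V -> bool}, (forall v, (x v <= y v)%O) -> f x <= f y.

Definition mutually_independent (R : realType) (V : finType)
    (d d' : measure_display) (T : measurableType d) (T' : measurableType d')
    (P : probability T R) (Y : V -> {RV P >-> T'}) : Prop :=
  forall (J : {set V}) (B : V -> set T'), (forall v, measurable (B v)) ->
    P (\bigcap_(v in [set` J]) (Y v @^-1` B v)) =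
    (\prod_(v in J) P (Y v @^-1` B v))%E.

Definition iid_bernoulli (R : realType) (V : finType)
    (d : measure_display) (T : measurableType d)
    (P : probability T R) (p : R) (Y : V -> {RV P >-> bool}) : Prop :=
  mutually_independent Y /\
  forall v, distribution P (Y v) =1 bernoulli_prob p.

(* The expectation of [f] of a sequence of independent Bernoulli variables with
   parameters [q v], as a finite sum over the cube. *)
Definition bernoulli_expectation (R : realType) (V : finType)
    (q : V -> R) (f : {ffun V -> bool} -> R) : R :=
  \sum_(x : {ffun V -> bool}) (\prod_(v : V) bernoulli_pmf (q v) (x v)) * f x.

(* At q v = 0 and q v = 1 the offending term is 0 * ln 0 = 0. *)
Definition bernoulli_KL (R : realType) (V : finType) (q : V -> R) (p : R) : R :=
  \sum_(v : V) (q v * ln (q v / p) + (1 - q v) * ln ((1 - q v) / (1 - p))).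

(* An infimum in the extended reals, hence +oo when no q is feasible. For
   0 < p < 1 it is a minimum otherwise: the divergence is continuous on the
   compact set of feasible q. *)
Definition Phi (R : realType) (V : finType) (p : R)
    (f : {ffun V -> bool} -> R) (eta : R) : \bar R :=
  ereal_inf [set (bernoulli_KL q p)%:E | q in
    [set q : V -> R | (forall v, 0 <= q v <= 1) /\
      bernoulli_expectation q f <=
        eta * bernoulli_expectation (fun=> p) f]].

(* Main.v *)
Require Import Defs.
From mathcomp Require Import all_boot all_order all_algebra.
From mathcomp Require Import all_classical all_reals all_analysis.
From mathcomp Require Import measurable_realfun ring lra.

Import Order.TTheory GRing.Theory Num.Theory.

Local Open Scope classical_set_scope.
Local Open Scope ring_scope.

(** The proof is a change of measure.  Fix a feasible [q], let [Q] be the law of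
    [Y^(q)] on the cube and [P] that of [Y], and let [A] be the set of points
    [x] with [f x <= eta E f(Y)].

    Replacing each [q v] by [min (q v) p] keeps [q] feasible, because [f] is
    increasing ([le_bernoulli_expectation], a monotone coupling), and does not
    increase the divergence ([bernoulli_KL_min]).  So let [q <= p].  By Markov's
    inequality ([bernoulli_markov]) [Q A >= delta], where [delta = min 1 eps].

    Let [L] be the log-likelihood ratio of [Q] to [P], whose [Q]-mean is the
    divergence [D].  Since [P x >= Q x * expR (- L x)], it would be enough that
    [L <= (1 + eps) D + t] with [Q]-probability at least [1 - delta / 2], for
    some [t] depending on [eps] and [p0] only: then
    [P A >= (delta / 2) * expR (- ((1 + eps) D + t))].

    That concentration is where [q <= p <= p0 < 1] enters.  For one coordinate,
    with log-likelihood ratio [l], the second moment of [l] is at most [K] times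
    the mean of [l], for a constant [K] depending on an upper bound for [l]
    ([sqr_ln_ratio_le]).  When [q v <= p], such a bound is [- ln (1 - p0)]; when
    [q v] exceeds [p], [l] may be as large as [- ln p], which is unbounded.
    Expanding the exponential to second order then gives
    [E expR (lam l) <= expR (lam (1 + eps) E l)] as soon as [lam] is small
    compared with [min 1 eps / K] ([bernoulli_llr_mgf]).  Multiplying over the
    coordinates and using the exponential Markov inequality,
    [Q (L > (1 + eps) D + t) <= expR (- lam t)], and [t] is chosen to make the
    right side [delta / 2] ([bernoulli_change_of_measure],
    [bernoulli_lower_tail]). *)

(** * Second-order bounds on the exponential *)

(** Square the tangent bound [1 + y / 2 <= expR (y / 2)], whose left side is
    nonnegative exactly when [-2 <= y]. *)
Lemma expR_ge_quadratic {R : realType} (y : R) :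
  -2 <= y -> 1 + y + y ^+ 2 / 4 <= expR y.
Proof.
move=> y2.
have -> : 1 + y + y ^+ 2 / 4 = (1 + y / 2) ^+ 2 by field.
have -> : expR y = expR (y / 2) ^+ 2 by rewrite -expRM_natl; congr expR; field.
by rewrite lerXn2r ?expR_ge1Dx// nnegrE ?expR_ge0//; lra.
Qed.

(** Since [expR (- y) >= 1 - y], it is enough that
    [(1 - y) * (1 + y + 2 * y ^+ 2) >= 1]; the difference is
    [y ^+ 2 * (1 - 2 * y)], whence the restriction on [y]. *)
Lemma expR_le_quadratic {R : realType} (y : R) :
  y <= 1 / 2 -> expR y <= 1 + y + 2 * y ^+ 2.
Proof.
move=> y2.
have h1 := expR_ge1Dx (- y).
have h2 : expR y * expR (- y) = 1 by rewrite -expRD subrr expR0.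
have h0 := expR_gt0 y.
have h3 : expR y * (1 - y) <= 1 by nra.
have h4 : 1 <= (1 - y) * (1 + y + 2 * y ^+ 2).
  have : 0 <= y ^+ 2 * (1 - 2 * y) by rewrite mulr_ge0 ?sqr_ge0//; lra.
  nra.
have : 0 < 1 - y by lra.
nra.
Qed.

(** Near 0 the gap in the tangent bound is quadratic.  Far to the left it is
    only linear, and the constant has to grow with [S] to make up for that. *)
Lemma sqr_le_expR_sub {R : realType} (S y : R) : 0 <= S -> - S <= y ->
  y ^+ 2 <= (4 + 2 * S) * (expR y - 1 - y).
Proof.
move=> S0 yS.
have [y2|y2] := leP (-2) y.
  have := expR_ge_quadratic y y2.
  have := sqr_ge0 y; nra.
have := expR_gt0 y.
nra.
Qed.

(** For [a > 0] this is [sqr_le_expR_sub] at [y = - ln (a / b)], multiplied by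
    [a].  Summed over the two atoms of a pair of Bernoulli laws, with [a] the
    tilted and [b] the original mass, the terms [b - a] cancel and the second
    moment of the log-likelihood ratio is bounded by its mean. *)
Lemma sqr_ln_ratio_le {R : realType} (S a b : R) : 0 <= S -> 0 <= a -> 0 < b ->
  ln (a / b) <= S ->
  a * ln (a / b) ^+ 2 <= (4 + 2 * S) * (b - a + a * ln (a / b)).
Proof.
move=> S0; rewrite le_eqVlt => /predU1P[<- b0 _|a0 b0 hl].
  by rewrite !mul0r subr0 addr0; nra.
have hb : a * expR (- ln (a / b)) = b.
  by rewrite expRN lnK ?posrE ?divr_gt0// invf_div mulrC divfK// gt_eqF.
have := sqr_le_expR_sub S (- ln (a / b)) S0.
rewrite lerN2 sqrrN opprK => /(_ hl) h.
rewrite -[X in X - a]hb.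
have -> : a * expR (- ln (a / b)) - a + a * ln (a / b) =
  a * (expR (- ln (a / b)) - 1 + ln (a / b)) by ring.
by rewrite [leRHS]mulrCA ler_pM2l.
Qed.

(** * One Bernoulli coordinate *)

Definition bernoulli_llr {R : realType} (q p : R) (b : bool) : R :=
  ln (bernoulli_pmf q b / bernoulli_pmf p b).

Definition bernoulli_KL1 {R : realType} (q p : R) : R :=
  q * ln (q / p) + (1 - q) * ln ((1 - q) / (1 - p)).

(** By [sqr_ln_ratio_le], [b - a + a * ln (a / b)] is nonnegative, because it
    dominates a square, up to a positive factor. *)
Lemma bernoulli_KL1_ge0 {R : realType} (q p : R) :
  0 <= q <= 1 -> 0 < p < 1 -> 0 <= bernoulli_KL1 q p.
Proof.
move=> /andP[q0 q1] /andP[p0 p1].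
have key (a b : R) : 0 <= a -> 0 < b -> 0 <= b - a + a * ln (a / b).
  move=> a0 b0.
  have := sqr_ln_ratio_le (Num.max 0 (ln (a / b))) a b.
  rewrite le_max lexx le_max lexx orbT => /(_ isT a0 b0 isT) h.
  have h1 : 0 <= a * ln (a / b) ^+ 2 by rewrite mulr_ge0 ?sqr_ge0.
  have h2 : 0 <= Num.max 0 (ln (a / b)) by rewrite le_max lexx.
  nra.
have := key q p q0 p0; have := key (1 - q) (1 - p).
rewrite subr_ge0 subr_gt0 => /(_ q1 p1); rewrite /bernoulli_KL1; lra.
Qed.

(** The moment generating function is at most
    [1 + lam D + 2 lam^2 (second moment) <= 1 + lam D (1 + 2 lam K)], where
    [K = 4 + 2 * S]; the condition on [lam] makes the last bracket at most
    [1 + eps], and also keeps [lam * l] below [1 / 2]. *)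
Lemma bernoulli_llr_mgf {R : realType} (S eps lam q p : R) :
  0 < eps -> 0 <= lam -> 2 * lam * (4 + 2 * S) <= Num.min 1 eps ->
  0 <= q <= p -> 0 < p < 1 -> - ln (1 - p) <= S ->
  bernoulli_pmf q true * expR (lam * bernoulli_llr q p true) +
    bernoulli_pmf q false * expR (lam * bernoulli_llr q p false) <=
  expR (lam * (1 + eps) * bernoulli_KL1 q p).
Proof.
move=> eps0 lam0; rewrite le_min => /andP[lam1 lameps] /andP[q0 qp].
move=> /andP[p0 p1] hS.
have S0 : 0 <= S.
  by apply: le_trans hS; rewrite oppr_ge0 ln_le0//; lra.
have q1 : 0 < 1 - q by lra.
have r1 : 0 < 1 - p by lra.
rewrite /bernoulli_llr/=.
have lt_S : ln (q / p) <= S.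
  by apply: le_trans S0; rewrite ln_le0// ler_pdivrMr// mul1r.
have lf_S : ln ((1 - q) / (1 - p)) <= S.
  apply: le_trans hS; rewrite ln_div ?posrE// gerDr ln_le0//; lra.
have ht := sqr_ln_ratio_le S q p S0 q0 p0 lt_S.
have hf := sqr_ln_ratio_le S (1 - q) (1 - p) S0 (ltW q1) r1 lf_S.
have D0 := @bernoulli_KL1_ge0 _ q p.
rewrite q0 p0 p1 (le_trans qp (ltW p1)) in D0; move: (D0 isT isT) => {}D0.
have quad l : l <= S -> expR (lam * l) <= 1 + lam * l + 2 * (lam * l) ^+ 2.
  move=> lS; apply: expR_le_quadratic.
  have : lam * l <= lam * S by rewrite ler_wpM2l.
  nra.
have ht' := ler_wpM2l q0 (quad _ lt_S).
have hf' := ler_wpM2l (ltW q1) (quad _ lf_S).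
apply: le_trans (lerD ht' hf') _.
apply: le_trans (expR_ge1Dx _).
rewrite /bernoulli_KL1 in D0 *.
set a := ln (q / p) in ht hf D0 *; set b := ln (_ / _) in ht hf D0 *.
set D := q * a + _ in D0 *.
have hsum : q * a ^+ 2 + (1 - q) * b ^+ 2 <= (4 + 2 * S) * D.
  by rewrite /D; lra.
have -> : q * (1 + lam * a + 2 * (lam * a) ^+ 2) +
   (1 - q) * (1 + lam * b + 2 * (lam * b) ^+ 2) =
   1 + lam * D + 2 * lam ^+ 2 * (q * a ^+ 2 + (1 - q) * b ^+ 2).
  by rewrite /D; ring.
have h1 : 2 * lam ^+ 2 * (q * a ^+ 2 + (1 - q) * b ^+ 2) <=
  2 * lam ^+ 2 * ((4 + 2 * S) * D).
  by rewrite ler_wpM2l// mulr_ge0// sqr_ge0.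
have h2 : 2 * lam * (4 + 2 * S) * (lam * D) <= eps * (lam * D).
  by rewrite ler_wpM2r// mulr_ge0.
lra.
Qed.

(** * Product Bernoulli measures on the cube *)

Lemma sum_cube_prod {R : realType} {V : finType} (F : V -> bool -> R) :
  \sum_(x : {ffun V -> bool}) \prod_(v : V) F v (x v) =
  \prod_(v : V) (F v true + F v false).
Proof.
by rewrite -bigA_distr_bigA; apply: eq_bigr => v _; rewrite big_bool.
Qed.

Lemma bernoulli_expectation1 {R : realType} {V : finType} (q : V -> R) :
  bernoulli_expectation q (fun=> 1) = 1.
Proof.
rewrite /bernoulli_expectation; under eq_bigr do rewrite mulr1.
rewrite (sum_cube_prod (fun v => bernoulli_pmf (q v))) big1//= => v _; ring.
Qed.

(** Stochastic monotonicity.  Couple the two laws coordinatewise by [c v], where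
    [c v a b] is the mass given to the value [a] under [q] and [b] under [r];
    the pair with [a = false] and [b = true] gets mass 0, so the coupling is
    supported on pairs of comparable points. *)
Lemma le_bernoulli_expectation {R : realType} {V : finType} (r q : V -> R)
    (f : {ffun V -> bool} -> R) :
  (forall v, 0 <= r v) -> (forall v, r v <= q v) -> (forall v, q v <= 1) ->
  increasing f -> bernoulli_expectation r f <= bernoulli_expectation q f.
Proof.
move=> r0 rq q1 hf.
pose c v (a b : bool) : R :=
  if a then (if b then r v else q v - r v) else (if b then 0 else 1 - q v).
have c0 v a b : 0 <= c v a b.
  by rewrite /c; case: a; case: b; rewrite ?subr_ge0.
have -> : bernoulli_expectation r f =
    \sum_(y : {ffun V -> bool}) \sum_(x : {ffun V -> bool})
      (\prod_v c v (x v) (y v)) * f y.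
  apply: eq_bigr => y _; rewrite -mulr_suml; congr (_ * _).
  rewrite (sum_cube_prod (fun v a => c v a (y v))).
  by apply: eq_bigr => v _; rewrite /c /bernoulli_pmf; case: (y v); ring.
have -> : bernoulli_expectation q f =
    \sum_(x : {ffun V -> bool}) \sum_(y : {ffun V -> bool})
      (\prod_v c v (x v) (y v)) * f x.
  apply: eq_bigr => x _; rewrite -mulr_suml; congr (_ * _).
  rewrite (sum_cube_prod (fun v b => c v (x v) b)).
  by apply: eq_bigr => v _; rewrite /c /bernoulli_pmf; case: (x v); ring.
rewrite exchange_big/=; apply: ler_sum => x _; apply: ler_sum => y _.
have [/forallP yx|] := boolP [forall v, (y v <= x v)%O].
  by rewrite ler_wpM2l ?prodr_ge0//; exact: hf.
rewrite negb_forall => /existsP[v yxv].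
suff -> : \prod_v c v (x v) (y v) = 0 by rewrite !mul0r.
apply/eqP/prodf_eq0; exists v => //; move: yxv.
by rewrite /c; case: (x v); case: (y v).
Qed.

Lemma bernoulli_weight_ge0 {R : realType} {V : finType} (q : V -> R)
    (x : {ffun V -> bool}) :
  (forall v, 0 <= q v <= 1) -> 0 <= \prod_v bernoulli_pmf (q v) (x v).
Proof. by move=> q01; apply: prodr_ge0 => v _; exact: bernoulli_pmf_ge0. Qed.

(** The two sides differ only at a value of zero mass under [q]: there the left
    side is 0, whatever the default value of [ln 0]. *)
Lemma bernoulli_pmf_llr {R : realType} (q p : R) (b : bool) :
  0 <= q <= 1 -> 0 < p < 1 ->
  bernoulli_pmf q b * expR (- bernoulli_llr q p b) <= bernoulli_pmf p b.
Proof.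
move=> q01 /andP[p0 p1].
have pb0 : 0 < bernoulli_pmf p b by rewrite /bernoulli_pmf; case: b; lra.
have := bernoulli_pmf_ge0 b q01; rewrite le_eqVlt => /predU1P[<-|qb0].
  by rewrite mul0r ltW.
by rewrite expRN lnK ?posrE ?divr_gt0// invf_div mulrC divfK// gt_eqF.
Qed.

(** The minimum covers the degenerate case [b = 0], where [f] vanishes almost
    surely and the probability is 1, whatever the size of [eps]. *)
Lemma bernoulli_markov {R : realType} {V : finType} (q : V -> R)
    (f : {ffun V -> bool} -> R) (eps b : R) :
  (forall v, 0 <= q v <= 1) -> (forall x, 0 <= f x) -> 0 <= b ->
  bernoulli_expectation q f <= (1 - eps) * b ->
  Num.min 1 eps <= bernoulli_expectation q (fun x => (f x <= b)%R%:R).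
Proof.
move=> q01 f0; rewrite le_eqVlt => /predU1P[<-|b0] hE.
  rewrite mulr0 in hE; rewrite ge_min; apply/orP; left.
  rewrite -[leLHS](bernoulli_expectation1 q); apply: ler_sum => x _.
  have [fx|fx] := leP (f x) 0; first by [].
  rewrite mulr0 mulr1 -(pmulr_lle0 _ fx); apply: le_trans hE.
  rewrite /bernoulli_expectation (bigD1 x)//= lerDl.
  by apply: sumr_ge0 => y _; rewrite mulr_ge0// bernoulli_weight_ge0.
rewrite ge_min; apply/orP; right.
(* Sum the pointwise bound [b * (1 - indicator of (f <= b)) <= f]. *)
suff : b * (1 - bernoulli_expectation q (fun x => (f x <= b)%R%:R)) <=
    bernoulli_expectation q f by nra.
rewrite -[X in b * (X - _)](bernoulli_expectation1 q).
rewrite /bernoulli_expectation -sumrB mulr_sumr.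
apply: ler_sum => x _; rewrite -mulrBr mulrCA ler_wpM2l ?bernoulli_weight_ge0//.
by have [fx|/ltW fx] := leP (f x) b; rewrite ?subrr ?subr0 ?mulr0 ?mulr1.
Qed.

(** The bound [P A >= expR (- c) * (Q A - Q (L > c))] for [c = (1 + eps) D + t],
    with [Q (L > c)] replaced by its Chernoff bound.  Using
    [expR (lam * (L x - c))] in place of the indicator of [L > c] reduces the
    argument to a pointwise inequality and one moment generating function,
    which factorizes over the coordinates. *)
Lemma bernoulli_change_of_measure {R : realType} {V : finType} (S eps lam t : R)
    (p : R) (q : V -> R) (A : pred {ffun V -> bool}) :
  0 < eps -> 0 <= lam -> 2 * lam * (4 + 2 * S) <= Num.min 1 eps ->
  0 < p < 1 -> - ln (1 - p) <= S -> (forall v, 0 <= q v <= p) ->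
  expR (- ((1 + eps) * bernoulli_KL q p + t)) *
    (bernoulli_expectation q (fun x => (A x)%:R) - expR (- (lam * t))) <=
  bernoulli_expectation (fun=> p) (fun x => (A x)%:R).
Proof.
move=> eps0 lam0 hlam p01 hS qp.
have q01 v : 0 <= q v <= 1.
  by have := qp v; have := p01; move=> /andP[_ ?] /andP[-> ?] /=; lra.
pose L (x : {ffun V -> bool}) := \sum_v bernoulli_llr (q v) p (x v).
set D := bernoulli_KL q p; set c := (1 + eps) * D + t.
have mgf : bernoulli_expectation q (fun x => expR (lam * L x)) <=
    expR (lam * (1 + eps) * D).
  have -> : bernoulli_expectation q (fun x => expR (lam * L x)) =
      \prod_v (bernoulli_pmf (q v) true *
                 expR (lam * bernoulli_llr (q v) p true) +
               bernoulli_pmf (q v) false *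
                 expR (lam * bernoulli_llr (q v) p false)).
    rewrite -(sum_cube_prod (fun v b =>
      bernoulli_pmf (q v) b * expR (lam * bernoulli_llr (q v) p b))).
    by apply: eq_bigr => x _; rewrite big_split/= -expR_sum /L mulr_sumr.
  rewrite /D /bernoulli_KL mulr_sumr expR_sum; apply: ler_prod => v _.
  rewrite addr_ge0 ?mulr_ge0 ?expR_ge0 ?bernoulli_pmf_ge0//=.
  exact: (bernoulli_llr_mgf S).
have likelihood (x : {ffun V -> bool}) :
    (\prod_v bernoulli_pmf (q v) (x v)) * expR (- L x) <=
    \prod_(v : V) bernoulli_pmf p (x v).
  rewrite /L -sumrN expR_sum -big_split/=; apply: ler_prod => v _.
  by rewrite mulr_ge0 ?expR_ge0 ?bernoulli_pmf_ge0//= bernoulli_pmf_llr.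
(* If [A x] fails or [c < L x], the left side is nonpositive; if [A x] holds
   and [L x <= c], then [expR (- c) <= expR (- L x)] and the likelihood bound
   applies. *)
have pointwise (x : {ffun V -> bool}) :
    expR (- c) * ((\prod_v bernoulli_pmf (q v) (x v)) *
      ((A x)%:R - expR (lam * (L x - c)))) <=
    (\prod_(v : V) bernoulli_pmf p (x v)) * (A x)%:R.
  have w0 := bernoulli_weight_ge0 q x q01.
  have p0 : 0 <= \prod_(v : V) bernoulli_pmf p (x v).
    by apply: bernoulli_weight_ge0 => _; move: p01 => /andP[/ltW-> /ltW->].
  have neg (y : R) : y <= 0 ->
      expR (- c) * ((\prod_v bernoulli_pmf (q v) (x v)) * y) <= 0.
    by move=> y0; rewrite mulr_ge0_le0 ?expR_ge0// mulr_ge0_le0.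
  case: (A x) => /=; last first.
    by rewrite mulr0; apply: neg; rewrite sub0r oppr_le0 expR_ge0.
  have [Lc|Lc] := leP (L x) c; last first.
    rewrite mulr1; apply: le_trans p0; apply: neg.
    by rewrite subr_le0 -[leLHS]expR0 ler_expR mulr_ge0// subr_ge0 ltW.
  rewrite mulr1; apply: le_trans (likelihood x).
  rewrite mulrCA ler_wpM2l// -[leRHS]mulr1 ler_pM ?expR_ge0 ?ler_expR ?lerN2//.
    by rewrite subr_ge0 -[leRHS]expR0 ler_expR mulr_ge0_le0// subr_le0.
apply: le_trans (ler_sum _ (fun x _ => pointwise x)).
rewrite -mulr_sumr ler_wpM2l ?expR_ge0//.
under eq_bigr do rewrite mulrBr.
rewrite sumrB lerD2l lerN2.
under eq_bigr do rewrite mulrBr expRB mulrA.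
rewrite -mulr_suml.
have -> : expR (- (lam * t)) = expR (lam * (1 + eps) * D) / expR (lam * c).
  by rewrite -expRB; congr expR; rewrite /c; ring.
by rewrite ler_wpM2r// invr_ge0 expR_ge0.
Qed.

(** A coordinate with [q v > p] is moved to [p], where its term is 0; the others
    do not change. *)
Lemma bernoulli_KL_min {R : realType} {V : finType} (q : V -> R) (p : R) :
  0 < p < 1 -> (forall v, 0 <= q v <= 1) ->
  bernoulli_KL (fun v => Num.min (q v) p) p <= bernoulli_KL q p.
Proof.
move=> p01 q01; apply: ler_sum => v _.
have [//|_] := leP (q v) p.
have /andP[p0 p1] := p01.
rewrite !divff ?subr_eq0 ?(gt_eqF p0) ?(gt_eqF p1)// ln1 !mulr0 addr0.
exact: bernoulli_KL1_ge0.
Qed.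

(** Take [t = lam^-1 * ln (2 / delta)], so that the Chernoff term is
    [delta / 2], half of the mass that Markov's inequality gives to the event.
    The remaining factor [delta / 2] accounts for the other [ln (2 / delta)]. *)
Lemma bernoulli_lower_tail {R : realType} {V : finType} (S eps lam : R)
    (p : R) (q : V -> R) (f : {ffun V -> bool} -> R) (eta : R) :
  0 < eps -> 0 < lam -> 2 * lam * (4 + 2 * S) <= Num.min 1 eps ->
  0 < p < 1 -> - ln (1 - p) <= S -> (forall v, 0 <= q v <= 1) ->
  (forall x, 0 <= f x) -> increasing f -> 0 <= eta ->
  bernoulli_expectation q f <=
    (1 - eps) * eta * bernoulli_expectation (fun=> p) f ->
  expR (- ((1 + eps) * bernoulli_KL q p +
           (1 + lam^-1) * ln (2 / Num.min 1 eps))) <=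
  bernoulli_expectation (fun=> p)
    (fun x => (f x <= eta * bernoulli_expectation (fun=> p) f)%R%:R).
Proof.
move=> eps0 lam0 hlam p01 hS q01 f0 hf eta0 hq.
set delta := Num.min 1 eps in hlam *.
have delta0 : 0 < delta by rewrite /delta lt_min ltr01.
pose r v := Num.min (q v) p.
have rp v : 0 <= r v <= p.
  rewrite /r le_min ge_min lexx orbT andbT.
  by have /andP[-> _] := q01 v; have /andP[/ltW-> _] := p01.
have r01 v : 0 <= r v <= 1.
  by have := rp v; have := p01; move=> /andP[_ ?] /andP[-> ?] /=; lra.
set b := eta * bernoulli_expectation _ f.
have b0 : 0 <= b.
  rewrite mulr_ge0// sumr_ge0// => x _.
  rewrite mulr_ge0// bernoulli_weight_ge0//.
  by move=> _; move: p01 => /andP[/ltW-> /ltW->].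
have hr : bernoulli_expectation r f <= (1 - eps) * b.
  rewrite /b mulrA; apply: le_trans hq; apply: le_bernoulli_expectation => // v.
  - by have /andP[] := rp v.
  - by rewrite /r ge_min lexx.
  - by have /andP[] := q01 v.
have mk := bernoulli_markov r f eps b r01 f0 b0 hr.
set l := ln (2 / delta).
have el : expR (- l) = delta / 2.
  by rewrite expRN lnK ?invf_div// posrE divr_gt0.
apply: le_trans (bernoulli_change_of_measure S eps lam (lam^-1 * l) p r
  (fun x => f x <= b) eps0 (ltW lam0) hlam p01 hS rp).
rewrite mulVKf ?gt_eqF// el.
have -> : - ((1 + eps) * bernoulli_KL q p + (1 + lam^-1) * l) =
  - ((1 + eps) * bernoulli_KL q p + lam^-1 * l) + - l by ring.
rewrite expRD el ler_pM ?expR_ge0 ?divr_ge0 ?(ltW delta0)//.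
  rewrite ler_expR lerN2 lerD2r ler_wpM2l//; first by lra.
  exact: bernoulli_KL_min.
move: mk; rewrite -/delta => mk; lra.
Qed.

(** * From random variables to the cube *)

Lemma iid_bernoulli_point {R : realType} {V : finType} {d : measure_display}
    {T : measurableType d} {P : probability T R} {p : R}
    {Y : V -> {RV P >-> bool}} : 0 <= p <= 1 -> iid_bernoulli p Y ->
  forall x : {ffun V -> bool},
  measurable [set t | [ffun v => Y v t] = x] /\
  P [set t | [ffun v => Y v t] = x] = (\prod_v bernoulli_pmf p (x v))%:E.
Proof.
move=> p01 [ind law] x.
have -> : [set t | [ffun v => Y v t] = x] =
    \bigcap_(v in [set` [set: V]%SET]) (Y v @^-1` [set x v]).
  apply/seteqP; split=> [t <- v _|t h]; first by rewrite /= ffunE.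
  by apply/ffunP => v; rewrite ffunE; apply: h; rewrite /= inE.
split.
  apply: fin_bigcap_measurable => // v _; exact: measurable_funPTI.
rewrite (ind _ (fun v => [set x v]))//.
rewrite -prodEFin; apply: eq_big => [v|v _]; first by rewrite inE.
have := law v [set x v]; rewrite /distribution /pushforward => ->.
rewrite bernoulli_probE// !diracE !in_set1.
by case: (x v); rewrite /= ?mule1 ?mule0 ?adde0 ?add0e.
Qed.

Lemma iid_bernoulli_integral {R : realType} {V : finType} {d : measure_display}
    {T : measurableType d} {P : probability T R} {p : R}
    {Y : V -> {RV P >-> bool}} (f : {ffun V -> bool} -> R) :
  0 <= p <= 1 -> iid_bernoulli p Y -> (forall x, 0 <= f x) ->
  (\int[P]_t (f [ffun v => Y v t])%:E)%E =
  (bernoulli_expectation (fun=> p) f)%:E.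
Proof.
move=> p01 hY f0.
pose E x := [set t | [ffun v => Y v t] = x].
have mE x : measurable (E x) := (iid_bernoulli_point p01 hY x).1.
transitivity (\int[P]_t \sum_x ((f x)%:E * (\1_(E x) t)%:E))%E.
  apply: eq_integral => t _.
  rewrite (bigD1 [ffun v => Y v t])//= big1 ?adde0 => [|x xt].
    by rewrite indicE mem_set// mule1.
  by rewrite indicE memNset ?mule0// /E/= => /esym/eqP; rewrite (negbTE xt).
rewrite ge0_integral_sum//.
- rewrite -sumEFin; apply: eq_bigr => x _.
  rewrite ge0_integralZl_EFin//.
    rewrite integral_indic// setIT EFinM muleC; congr (_ * _)%E.
    exact: (iid_bernoulli_point p01 hY x).2.
  by apply/measurable_EFinP; exact: measurable_indic.
- move=> x; apply: measurable_funeM; apply/measurable_EFinP.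
  exact: measurable_indic.
- by move=> x t _; rewrite mule_ge0 ?lee_fin.
Qed.

Lemma iid_bernoulli_prob {R : realType} {V : finType} {d : measure_display}
    {T : measurableType d} {P : probability T R} {p : R}
    {Y : V -> {RV P >-> bool}} (A : pred {ffun V -> bool}) :
  0 <= p <= 1 -> iid_bernoulli p Y ->
  P [set t | A [ffun v => Y v t]] =
  (bernoulli_expectation (fun=> p) (fun x => (A x)%:R))%:E.
Proof.
move=> p01 hY; rewrite -(iid_bernoulli_integral _ p01 hY) => [|x]; last first.
  by rewrite ler0n.
have mA : measurable [set t | A [ffun v => Y v t]].
  rewrite (_ : [set t | _] =
    \bigcup_(x in [set` A]) [set t | [ffun v => Y v t] = x]).
    apply: fin_bigcup_measurable => // x _.
    exact: (iid_bernoulli_point p01 hY x).1.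
  by apply/seteqP; split=> [t At|t [x Ax /= ->]//]; exists [ffun v => Y v t].
transitivity (\int[P]_t (\1_[set t | A [ffun v => Y v t]] t)%:E)%E.
  by rewrite integral_indic// setIT.
apply: eq_integral => t _; rewrite indicE.
rewrite (_ : t \in _ = A [ffun v => Y v t])//.
by apply/idP/idP; rewrite in_setE.
Qed.

Theorem theorem7 (R : realType) (p0 eps : R) (hp0 : p0 < 1) (heps : 0 < eps) :
  exists C : R,
  forall (p : R) (hp : 0 < p <= p0) (V : finType)
    (d : measure_display) (T : measurableType d) (P : probability T R)
    (Y : V -> {RV P >-> bool}) (hY : iid_bernoulli p Y)
    (f : {ffun V -> bool} -> R) (hf0 : forall x, 0 <= f x)
    (hf : increasing f) (eta : R) (heta : 0 <= eta),
  let X : T -> R := fun t => f [ffun v => Y v t] in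
  (- lne (P [set t | (X t)%:E <= eta%:E * 'E_P[X]]) <=
    (1 + eps)%:E * Phi p f ((1 - eps) * eta) + C%:E)%E.
Proof.
(* The absolute value makes [S] nonnegative without the sign of [p0]. *)
pose S := `|ln (1 - p0)|.
have K0 : 0 < 4 + 2 * S by have := normr_ge0 (ln (1 - p0)); rewrite -/S; lra.
pose delta := Num.min 1 eps.
have delta0 : 0 < delta by rewrite /delta lt_min ltr01.
pose lam := delta / (2 * (4 + 2 * S)).
have lam0 : 0 < lam by rewrite divr_gt0// mulr_gt0.
have hlam : 2 * lam * (4 + 2 * S) <= delta.
  by rewrite mulrAC mulrC /lam divfK// gt_eqF// mulr_gt0.
exists ((1 + lam^-1) * ln (2 / delta)).
move=> p /andP[p_gt0 pp0] V d T P Y hY f f0 hf eta eta0.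
cbv zeta; pose X := fun t : T => f [ffun v => Y v t].
have p1 : p < 1 by exact: le_lt_trans hp0.
have p01 : 0 <= p <= 1 by rewrite !ltW.
have hS : - ln (1 - p) <= S.
  apply: le_trans (_ : - ln (1 - p0) <= _).
    by rewrite lerN2 ler_ln ?posrE ?subr_gt0// lerD2l lerN2.
  by rewrite /S -normrN ler_norm.
have EX : 'E_P[X]%E = (bernoulli_expectation (fun=> p) f)%:E.
  by rewrite unlock (iid_bernoulli_integral f p01 hY f0).
rewrite EX -EFinM.
have := iid_bernoulli_prob
  (fun x => f x <= eta * bernoulli_expectation (fun=> p) f) p01 hY.
rewrite (_ : [set t | _] = [set t | ((f [ffun v => Y v t])%:E <=
    (eta * bernoulli_expectation (fun=> p) f)%:E)%E]) => [->|]; last first.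
  by apply/seteqP; split => t /=; rewrite lee_fin.
set PA := bernoulli_expectation _ _.
rewrite -leeBlDr// -lee_pdivrMl ?addr_gt0//.
(* It remains to bound the divergence of each feasible [q]; an empty infimum is
   covered as well. *)
apply/ereal_infP => _ [q [q01 hq] <-].
rewrite lee_pdivrMl ?addr_gt0// leeBlDr// -EFinM -EFinD.
have main : expR (- ((1 + eps) * bernoulli_KL q p +
    (1 + lam^-1) * ln (2 / delta))) <= PA.
  apply: (bernoulli_lower_tail S) => //; by rewrite p_gt0.
have PA0 : 0 < PA by apply: lt_le_trans main; rewrite expR_gt0.
rewrite lne_EFin// -EFinN lee_fin lerNl.
by rewrite -ler_expR lnK ?posrE.
Qed.
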